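(* A graph $G$ is $12$-representable by a $321$-avoiding word if and only if $G$ is a bipartite permutation graph.
   Context: All graphs are finite, simple and undirected. Let $[n]=\{1,\ldots,n\}$. For a word $w$ over positive integers, $\mathrm{red}(w)$ is the word obtained from $w$ by replacing each occurrence of the $i$th smallest letter with $i$. For a word (pattern) $p=p_1\cdots p_k$ with $\mathrm{red}(p)=p$, a word $w=w_1\cdots w_\ell$ contains $p$ if there are indices $i_1<\cdots<i_k$ with $\mathrm{red}(w_{i_1}\cdots w_{i_k})=p$; otherwise $w$ avoids $p$ (is $p$-avoiding). A labeled graph with vertex set $[n]$ is $12$-represented by a word $w$ over $[n]$ containing at least one copy of each letter of $[n]$ if for all $i<j$ in $[n]$: $i$ and $j$ are adjacent if and only if every occurrence of $j$ precedes every occurrence of $i$ in $w$. An (unlabeled) graph on $n$ vertices is $12$-representable by a $p$-avoiding word if its vertices can be labeled bijectively by $[n]$ so that the resulting labeled graph is $12$-represented by some $p$-avoiding word. The permutation graph of a permutation $\pi$ of $[n]$ (written as a word) is the graph on $[n]$ in which $i<j$ are adjacent if and only if $j$ occurs before $i$ in $\pi$; a graph is a permutation graph if it is isomorphic to the permutation graph of some permutation. A bipartite permutation graph is a permutation graph that is bipartite. *)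

(* Defs.v *)
From mathcomp Require Import all_boot all_fingroup.

Set Implicit Arguments.
Unset Strict Implicit.
Unset Printing Implicit Defensive.

(* The label set [n] = {1, ..., n} is encoded as 'I_n, that
   is {0, ..., n-1}; only the order of the labels matters below, since [red]
   always produces letters numbered from 1. *)

(* The ith smallest letter of w is the letter x such that exactly i distinct
   letters of w are at most x. *)
Definition red (w : seq nat) : seq nat :=
  [seq count (fun y => y <= x) (undup w) | x <- w].

(* A choice of increasing indices in w amounts to a subsequence of w. *)
Definition contains (p w : seq nat) : Prop :=
  exists2 s : seq nat, subseq s w & red s = p.

Definition avoids (p w : seq nat) : Prop := ~ contains p w.

Definition represents12 (n : nat) (w : seq 'I_n) (e : rel 'I_n) : Prop :=
  (forall i : 'I_n, i \in w) /\
  (forall i j : 'I_n, i < j ->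
     (e i j <->
      forall a b : nat, onth w a = Some j -> onth w b = Some i -> a < b)).

(* [f] is the labeling, read from labels to vertices. *)
Definition representable12_avoiding (p : seq nat) (T : finType) (e : rel T)
  : Prop :=
  exists (f : 'I_#|T| -> T) (w : seq 'I_#|T|),
    [/\ bijective f,
        represents12 w (fun i j => e (f i) (f j)) &
        avoids p (map val w)].

Definition isomorphic (T T' : finType) (e : rel T) (e' : rel T') : Prop :=
  exists2 f : T -> T', bijective f & forall x y, e x y = e' (f x) (f y).

Definition perm_word (n : nat) (s : 'S_n) : seq 'I_n :=
  [seq s k | k <- enum 'I_n].

Definition occurs_before (n : nat) (s : 'S_n) (j i : 'I_n) : bool :=
  index j (perm_word s) < index i (perm_word s).

Definition perm_graph (n : nat) (s : 'S_n) : rel 'I_n :=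
  fun i j => (i < j) && occurs_before s j i || (j < i) && occurs_before s i j.

Definition permutation_graph (T : finType) (e : rel T) : Prop :=
  exists (n : nat) (s : 'S_n), isomorphic e (perm_graph s).

Definition bipartite (T : finType) (e : rel T) : Prop :=
  exists c : T -> bool, forall x y, e x y -> c x != c y.

Definition bipartite_permutation_graph (T : finType) (e : rel T) : Prop :=
  permutation_graph e /\ bipartite e.

(* Main.v *)
Require Import Defs.
From mathcomp Require Import all_boot all_fingroup.
From mathcomp Require Import zify.

(** In a 12-representing word the larger end of an edge comes before the smaller
    one, so the vertices of a triangle form a 321. Together with a way to keep
    one occurrence of each letter, this is all that the proof needs.

    Permutation graphs to words. The word of a permutation 12-represents its
    own permutation graph, and a 321 in it is a triangle
    ([bipartite_perm_word_avoids321]); a 2-colouring excludes triangles.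

    Words to permutation graphs. Let [w] be a 321-avoiding word representing
    the labeled graph [E]. Call a label upper if it has a smaller neighbour. A
    label with both a smaller and a larger neighbour would be the middle of a
    321, so every edge joins an upper label to a non-upper one: this is the
    2-colouring ([upper_colouring]). For [i < j], adjacency says that the last
    [j] precedes the first [i]. So keep one occurrence of each letter: the last one of an
    upper label, the first one of any other label. The order of the kept
    occurrences reads off the edges between an upper and a non-upper label by
    definition, and any other inversion [j] before [i] is extended to a 321 by
    a neighbour of [i] or of [j] ([adj_pos]). The extension can fail only when
    [j] is isolated; isolated vertices are therefore moved to the end of both
    the label order and the position order, which creates no inversion.
    Two linear orders whose inversions are the edges make a permutation graph
    ([permutation_graph_of_keys]). *)

Set Implicit Arguments.
Unset Strict Implicit.
Unset Printing Implicit Defensive.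

(** * Occurrences of 321 *)

Lemma red_eq321 (s : seq nat) :
  red s = [:: 3; 2; 1] <-> exists x y z, s = [:: x; y; z] /\ z < y < x.
Proof.
split=> [|[x [y [z [-> /andP[zy yx]]]]]]; last first.
  have zx := ltn_trans zy yx.
  rewrite /red /= !inE (gtn_eqF yx) (gtn_eqF zx) (gtn_eqF zy) /= !leqnn.
  by rewrite (ltnW zy) (ltnW yx) (ltnW zx)
             (ltn_geF zy) (ltn_geF yx) (ltn_geF zx).
case: s => [|x [|y [|z [|t s]]]] // H; exists x, y, z; split=> //; move: H.
rewrite /red /= !inE.
by case: (ltngtP x y) => ?; case: (ltngtP y z) => ?;
  case: (ltngtP x z) => ? //=; subst => //=; rewrite ?leqnn ?ltnn //=;
  move=> []; lia.
Qed.

Lemma subseq_onth (T : eqType) (w : seq T) (x y z : T) (a b c : nat) :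
  onth w a = Some x -> onth w b = Some y -> onth w c = Some z ->
  a < b < c -> subseq [:: x; y; z] w.
Proof.
move=> wa wb wc /andP[ab bc].
have cw : c < size w by rewrite -onthTE wc.
have -> : [:: x; y; z] = [seq nth x w i | i <- [:: a; b; c]].
  by rewrite /= (onth_nth x _ _ _ wa) (onth_nth x _ _ _ wb)
             (onth_nth x _ _ _ wc).
rewrite -{2}[w](mkseq_nth x); apply: map_subseq.
(* An increasing list of positions is what filtering all positions by
   membership in it returns, so it is a subsequence of them. *)
suff <- : [seq i <- iota 0 (size w) | i \in [:: a; b; c]] = [:: a; b; c].
  exact: filter_subseq.
apply: (irr_sorted_eq ltn_trans ltnn) => [||i].
- exact/(sorted_filter ltn_trans)/iota_ltn_sorted.
- by rewrite /= ab bc.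
rewrite mem_filter mem_iota /= add0n !inE.
by case: (i < size w) / boolP => //; rewrite ?andbT ?andbF // => iw; lia.
Qed.

Lemma contains321P (n : nat) (w : seq 'I_n) :
  contains [:: 3; 2; 1] (map val w) <->
  exists i j k : 'I_n, subseq [:: i; j; k] w /\ k < j < i.
Proof.
split=> [[s /subseqP[m _ ->]]|[i [j [k [sw lt]]]]]; last first.
  exists (map val [:: i; j; k]); first exact: map_subseq.
  by apply/red_eq321; exists i, j, k.
case/red_eq321=> x [y [z []]]; rewrite -map_mask.
case E: (mask m w) => [|i [|j [|k [|? ?]]]] //= [<- <- <-] lt.
by exists i, j, k; rewrite -E mask_subseq.
Qed.

(** * Permutation graphs from two linear orders *)

Section Rank.

Variables (T : finType) (a : T -> nat).
Hypothesis a_inj : injective a.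

Definition rank (x : T) : nat := #|[set y | a y < a x]|.

Lemma rank_lt_card x : rank x < #|T|.
Proof.
rewrite -cardsT; apply/proper_card/properP; split; first exact: subsetT.
by exists x; rewrite ?inE ?ltnn.
Qed.

Definition rank_ord (x : T) : 'I_#|T| := Ordinal (rank_lt_card x).

Lemma rank_ltE x y : (rank x < rank y) = (a x < a y).
Proof.
have le u v : a u <= a v -> rank u <= rank v.
  move=> uv; apply/subset_leq_card/subsetP => t; rewrite !inE => tu.
  exact: leq_trans tu uv.
case: (ltnP (a x) (a y)) => [xy|/le]; last by rewrite ltnNge => ->.
apply/proper_card/properP; split.
  by apply/subsetP => t; rewrite !inE => /ltn_trans; apply.
by exists x; rewrite !inE ?ltnn.
Qed.

Lemma rank_ord_inj : injective rank_ord.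
Proof.
move=> x y /(congr1 val) /= xy; apply: a_inj.
by have := rank_ltE x y; have := rank_ltE y x; rewrite xy ltnn; case: ltngtP.
Qed.

Lemma rank_ord_bij : bijective rank_ord.
Proof. by apply: inj_card_bij rank_ord_inj _; rewrite card_ord. Qed.

End Rank.

Lemma index_perm_word n (s : 'S_n) k : index (s k) (perm_word s) = k.
Proof. by rewrite index_map ?index_enum_ord //; exact: perm_inj. Qed.

Lemma perm_word_uniq n (s : 'S_n) : uniq (perm_word s).
Proof. by rewrite map_inj_uniq ?enum_uniq //; exact: perm_inj. Qed.

Lemma mem_perm_word n (s : 'S_n) i : i \in perm_word s.
Proof. by rewrite -[i](permKV s) map_f ?mem_enum. Qed.

(** Injective keys stand for linear orders on the vertices. Ranks turn them
    into permutations of the labels: the vertex with label [rank a x] sits at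
    position [rank b x] of the permutation word. *)
Lemma permutation_graph_of_keys (T : finType) (e : rel T) (a b : T -> nat) :
    injective a -> injective b ->
    (forall x y, e x y = (a x < a y) && (b y < b x)
                      || (a y < a x) && (b x < b y)) ->
  permutation_graph e.
Proof.
move=> a_inj b_inj eE.
have [g gK Kg] := rank_ord_bij b_inj.
have s_inj : injective (rank_ord a \o g).
  exact: inj_comp (rank_ord_inj a_inj) (can_inj Kg).
exists #|T|, (perm s_inj), (rank_ord a) => [|x y]; first exact: rank_ord_bij.
have idx z : index (rank_ord a z) (perm_word (perm s_inj)) = rank b z.
  have {1}-> : rank_ord a z = perm s_inj (rank_ord b z) by rewrite permE /= gK.
  exact: index_perm_word.
by rewrite /perm_graph /occurs_before !idx /= !rank_ltE eE.
Qed.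

Lemma permutation_graph_iso (T T' : finType) (e : rel T) (e' : rel T') :
  isomorphic e e' -> permutation_graph e' -> permutation_graph e.
Proof.
move=> [f f_bij fE] [n [s [g g_bij gE]]].
exists n, s, (g \o f) => [|x y]; first exact: bij_comp.
by rewrite fE gE.
Qed.

(** * First and last occurrences *)

Section Occurrences.

Variable T : eqType.
Implicit Types (w : seq T) (x : T).

Definition last_index x w : nat := (size w).-1 - index x (rev w).

Lemma onth_index x w : x \in w -> onth w (index x w) = Some x.
Proof.
by move=> xw; rewrite onthE (nth_map x) ?index_mem ?nth_index.
Qed.

Lemma index_le_onth x w a : onth w a = Some x -> index x w <= a.
Proof.
move=> wa; have aw : a < size w by rewrite -onthTE wa.
by rewrite -(onth_nth x _ _ _ wa) index_nth.
Qed.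

Lemma onth_last_index x w : x \in w -> onth w (last_index x w) = Some x.
Proof.
move=> xw; have xr : index x (rev w) < size w.
  by rewrite -size_rev index_mem mem_rev.
have lw : last_index x w < size w by rewrite /last_index; lia.
rewrite onthE (nth_map x) //.
rewrite -[w in nth _ w _]revK nth_rev ?size_rev //.
have -> : size w - (last_index x w).+1 = index x (rev w).
  by rewrite /last_index; lia.
by rewrite nth_index ?mem_rev.
Qed.

Lemma onth_le_last_index x w a : onth w a = Some x -> a <= last_index x w.
Proof.
move=> wa; have aw : a < size w by rewrite -onthTE wa.
have := @index_nth _ x (size w - a.+1) (rev w).
rewrite size_rev nth_rev; last by lia.
have -> : size w - (size w - a.+1).+1 = a by lia.
rewrite (onth_nth x _ _ _ wa) /last_index; lia.
Qed.

End Occurrences.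

(** Comparing the extreme occurrences suffices, and makes adjacency a single
    inequality between positions. *)
Lemma represents12_last_first n (w : seq 'I_n) (E : rel 'I_n) (i j : 'I_n) :
  represents12 w E -> i < j -> E i j = (last_index j w < index i w).
Proof.
move=> [mem adj] /adj ij; apply/idP/idP => [/ij|lt]; last first.
  apply/ij => a b /onth_le_last_index ja /index_le_onth ib.
  exact: leq_ltn_trans ja (leq_trans lt ib).
by apply; [exact: onth_last_index | exact: onth_index].
Qed.

(** * Graphs represented by a 321-avoiding word *)

Section Avoiding321.

Variables (n : nat) (w : seq 'I_n) (E : rel 'I_n).
Hypotheses (E_sym : symmetric E) (E_irr : irreflexive E).
Hypothesis wE : represents12 w E.
Hypothesis w321 : avoids [:: 3; 2; 1] (map val w).

Let first i := index i w.
Let last i := last_index i w.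
Let onth_first i : onth w (first i) = Some i := onth_index (wE.1 i).
Let onth_last i : onth w (last i) = Some i := onth_last_index (wE.1 i).
Let adjE (i j : 'I_n) : i < j -> E i j = (last j < first i) :=
  fun ij => represents12_last_first wE ij.

Definition upper (i : 'I_n) : bool := [exists h : 'I_n, (h < i) && E h i].

Lemma upperP (i : 'I_n) :
  reflect (exists2 h : 'I_n, h < i & last i < first h) (upper i).
Proof.
apply: (iffP existsP) => [[h /andP[hi]]|[h hi lt]].
  by rewrite adjE //; exists h.
by exists h; rewrite hi adjE.
Qed.

Lemma no_descent3 (k j i : 'I_n) (a b c : nat) :
  onth w a = Some k -> onth w b = Some j -> onth w c = Some i ->
  i < j < k -> ~~ (a < b < c).
Proof.
move=> wa wb wc ijk; apply/negP => /(subseq_onth wa wb wc) s; apply: w321.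
by apply/contains321P; exists k, j, i.
Qed.

(** If the smaller end [i] of an edge [i < j] had itself a smaller neighbour
    [h], then a [j], an [i] and an [h] would follow one another in [w]. *)
Lemma upper_edge (i j : 'I_n) : i < j -> E i j -> upper j && ~~ upper i.
Proof.
move=> ij eij; apply/andP; split; first by apply/existsP; exists i; rewrite ij.
apply/negP => /upperP[h hi lt].
have := no_descent3 (onth_last j) (onth_first i) (onth_first h).
move: eij; rewrite adjE // hi ij => -> /(_ isT); rewrite /= -leqNgt.
by rewrite leqNgt (leq_ltn_trans (onth_le_last_index (onth_first i))).
Qed.

Lemma upper_colouring (i j : 'I_n) : E i j -> upper i != upper j.
Proof.
case: (ltngtP i j) => [ij|ji|/ord_inj->] e; last by rewrite E_irr in e.
- by have /andP[-> /negPf->] := upper_edge ij e.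
- by rewrite E_sym in e; have /andP[-> /negPf->] := upper_edge ji e.
Qed.

(** The kept occurrence of a label. An edge [i < j] compares the last [j] with
    the first [i], and there [j] is upper while [i] is not. *)
Definition pos (i : 'I_n) : nat := if upper i then last i else first i.

Lemma onth_pos i : onth w (pos i) = Some i.
Proof. by rewrite /pos; case: ifP. Qed.

Definition isolated (i : 'I_n) : bool := [forall j, ~~ E i j].

(** A non-adjacent pair [i < j] with [j] kept before [i] would give a 321. If
    [i] is upper, a smaller neighbour of [i] provides the last letter. If
    neither is upper, a neighbour of [j] is larger than [j], so it provides the
    first letter. Isolation of [j] must be excluded: in the word 2 1 2 no label
    has a neighbour, yet the first 2 precedes the first 1. *)
Lemma adj_pos (i j : 'I_n) : i < j -> ~~ isolated j ->
  E i j = (pos j < pos i).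
Proof.
move=> ij /forallPn[k]; rewrite negbK => ejk.
have [eij|neij] := boolP (E i j).
  have /andP[uj /negPf ui] := upper_edge ij eij.
  by rewrite /pos uj ui -adjE.
apply/esym/negbTE/negP.
have [/upperP[h hi lt] pji|ui] := boolP (upper i).
  have pil : pos i <= last i by exact/onth_le_last_index/onth_pos.
  have := no_descent3 (onth_pos j) (onth_last i) (onth_first h).
  by rewrite hi ij lt (leq_trans pji pil) => /(_ isT).
have [uj|uj] := boolP (upper j).
  by rewrite /pos (negPf ui) uj -adjE // (negPf neij).
have jk : j < k.
  case: (ltngtP j k) => [//|kj|/ord_inj jk]; last by rewrite jk E_irr in ejk.
  by case/negP: uj; apply/existsP; exists k; rewrite kj E_sym.
rewrite /pos (negPf ui) (negPf uj) => lt.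
have := no_descent3 (onth_last k) (onth_first j) (onth_first i).
by rewrite ij jk lt -adjE // ejk => /(_ isT).
Qed.

Lemma represented_permutation_graph : permutation_graph E.
Proof.
(* The offsets exceed every label and every position, so isolated vertices
   come last, in the same relative order, for both keys. *)
pose a (i : 'I_n) := if isolated i then n + i else i : nat.
pose b (i : 'I_n) := if isolated i then size w + i else pos i.
have pw i : pos i < size w by rewrite -onthTE onth_pos.
have isoE i j : isolated i -> E i j = false by move=> /forallP/(_ j)/negPf.
apply: (@permutation_graph_of_keys _ _ a b) => [i j|i j|i j].
- rewrite /a; have := ltn_ord i; have := ltn_ord j.
  by case: ifP => _; case: ifP => _ ? ? ?; apply: ord_inj => /=; lia.
- rewrite /b; have := pw i; have := pw j.
  case: ifP => _; case: ifP => _ ? ?; try (by move=> ?; apply: ord_inj; lia).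
  by move=> ij; have := onth_pos i; rewrite ij onth_pos => -[].
rewrite /a /b; have pi := pw i; have pj := pw j.
have li := ltn_ord i; have lj := ltn_ord j.
have [ii|ii] := boolP (isolated i); have [ij|ij] := boolP (isolated j).
- by rewrite isoE //; lia.
- by rewrite isoE //; lia.
- by rewrite E_sym isoE //; lia.
case: (ltngtP i j) => [lt|gt|/ord_inj<-] /=; last by rewrite E_irr.
- by rewrite orbF; exact: adj_pos.
- by rewrite E_sym; exact: adj_pos.
Qed.

End Avoiding321.

(** * The word of a permutation *)

Lemma represents12_perm_word n (s : 'S_n) :
  represents12 (perm_word s) (perm_graph s).
Proof.
split=> [i|i j ij]; first exact: mem_perm_word.
have at_index k a : onth (perm_word s) a = Some k -> a = index k (perm_word s).
  move=> wa; have aw : a < size (perm_word s) by rewrite -onthTE wa.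
  by rewrite -{1}(onth_nth k _ _ _ wa) index_uniq // perm_word_uniq.
rewrite /perm_graph ij ltnNge (ltnW ij) orbF /=.
split=> [lt a b /at_index-> /at_index-> //|]; apply;
  by rewrite onth_index ?mem_perm_word.
Qed.

(** The three letters of a 321 in the word are pairwise inverted, hence form a
    triangle, which has no 2-colouring. *)
Lemma bipartite_perm_word_avoids321 n (s : 'S_n) :
  bipartite (perm_graph s) -> avoids [:: 3; 2; 1] (map val (perm_word s)).
Proof.
move=> [c cE] /contains321P[i [j [k [sub /andP[kj ji]]]]].
have w_sorted : pairwise (occurs_before s) (perm_word s).
  apply/(pairwiseP i) => a b aw bw ab.
  by rewrite /occurs_before !index_uniq ?perm_word_uniq.
have /= := subseq_pairwise sub w_sorted.
rewrite !andbT => /andP[/andP[ij ik] jk].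
have edge (x y : 'I_n) : x < y -> occurs_before s y x -> c x != c y.
  by move=> xy yx; apply: cE; rewrite /perm_graph xy yx.
move: (edge _ _ kj jk) (edge _ _ ji ij) (edge _ _ (ltn_trans kj ji) ik).
by case: (c i) (c j) (c k) => [] [] [].
Qed.

Theorem theorem24 (T : finType) (e : rel T)
    (e_sym : symmetric e) (e_irr : irreflexive e) :
  representable12_avoiding [:: 3; 2; 1] e <-> bipartite_permutation_graph e.
Proof.
split=> [[f [w [[g fK gK] wE w321]]]|].
  set E := fun i j => e (f i) (f j) in wE.
  have E_sym : symmetric E by move=> i j; exact: e_sym.
  have E_irr : irreflexive E by move=> i; exact: e_irr.
  have eE x y : e x y = E (g x) (g y) by rewrite /E !gK.
  split.
    apply: permutation_graph_iso
             (represented_permutation_graph E_sym E_irr wE w321).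
    by exists g => //; exists f.
  exists (upper E \o g) => x y; rewrite eE.
  exact: (upper_colouring E_sym E_irr wE w321).
move=> [[n [s [g g_bij gE]]] [c cE]].
have nT : n = #|T| by rewrite (bij_eq_card g_bij) card_ord.
subst n; case: g_bij => f gK fK.
exists f, (perm_word s); split; first by exists g.
- have [mem adj] := represents12_perm_word s.
  by split=> // i j ij; rewrite gE !fK; exact: adj.
apply: bipartite_perm_word_avoids321; exists (c \o f) => i j ij.
by apply: cE; rewrite gE !fK.
Qed.
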